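(* Let $A,B,C,D$ be positive integers such that $A<B<C<D$ and $C-A=D-B$. Let $a=A/2$, $b=B/2$, $c=C/2$, $d=D/2$, and suppose that exactly two of $a,b,c,d$ are integers, so that the billiard table with successive corners at $a,b,c,d$ has exactly two corner pockets. Then the $45$ degree path between the two pockets touches all of the integer points along the perimeter of the table if and only if the double-sides $B-A$ and $C-B$ of the rectangle are relatively prime.
   Context: The billiard table with successive corners at $a<b<c<d$ (where $c-a=d-b$) is a rectangle whose boundary is parametrized by arc length with coordinates taken modulo the perimeter $P=2(c-a)=2(d-b)=C-A=D-B$; going once around the boundary in the direction of increasing coordinate, the four corners are met at coordinates $a,b,c,d$ in this order. Its side lengths are thus $b-a=d-c$ and $c-b\equiv a-d \pmod P$; twice the side lengths, $B-A$ and $C-B$, are called the double-sides. The integer points along the perimeter are the $P$ boundary points whose coordinate is an integer mod $P$. A pocket is a corner whose coordinate is an integer. The billiard ball travels in straight lines making a $45$ degree angle with the sides, and reflects (angle of incidence equal to angle of reflection) at each non-corner boundary point it hits; it starts at a pocket, leaving along the bisector of the right angle there, and stops on reaching a pocket. (When there are exactly two pockets, the path started at one of them ends at the other; this is the $45$ degree path between the pockets.) Equivalently, a boundary point with coordinate $x$ is joined by $45$ degree segments to the boundary points with coordinates $A-x$ and $B-x$ modulo $P$ (where $A\equiv C$ and $B\equiv D$ modulo $P$). The path touches a boundary point if it starts, bounces, or ends there. *)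

(* Defs.v *)
From mathcomp Require Import all_boot all_order all_algebra.
From mathcomp Require Import reals.

Set Implicit Arguments.
Unset Strict Implicit.
Unset Printing Implicit Defensive.

Import Order.TTheory GRing.Theory Num.Theory.
Local Open Scope ring_scope.

(* A billiard table, given by the boundary coordinates of its successive
   corners; it is a rectangle when a < b < c < d and c - a = d - b. *)
Record table (R : realType) := Table {
  cornerA : R; cornerB : R; cornerC : R; cornerD : R }.

Definition corners (R : realType) (T : table R) : seq R :=
  [:: cornerA T; cornerB T; cornerC T; cornerD T].

Definition perimeter (R : realType) (T : table R) : R :=
  2 * (cornerC T - cornerA T).

Definition width (R : realType) (T : table R) : R := cornerB T - cornerA T.
Definition height (R : realType) (T : table R) : R := cornerC T - cornerB T.

(* The table is realized in the plane as [0, width] x [0, height], with the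
   corners a, b, c, d at (0, 0), (width, 0), (width, height), (0, height).
   [boundary_point T x] is the boundary point of coordinate x, which only
   matters modulo the perimeter: t below is the representative of x in
   [a, a + perimeter[. *)
Definition boundary_point (R : realType) (T : table R) (x : R) : R * R :=
  let t := x - (Num.floor ((x - cornerA T) / perimeter T))%:~R * perimeter T in
  if t <= cornerB T then (t - cornerA T, 0)
  else if t <= cornerC T then (width T, t - cornerB T)
  else if t <= cornerD T then (width T - (t - cornerC T), height T)
  else (0, height T - (t - cornerD T)).

Definition integer_point (R : realType) (T : table R) (z : R * R) : Prop :=
  exists n : int, z = boundary_point T n%:~R.

Definition pocket (R : realType) (T : table R) (z : R * R) : Prop :=
  exists e : R, [/\ e \in corners T, e \is a Num.int & z = boundary_point T e].

(* The ball has a position and a velocity; both velocity components are 1 or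
   -1, so that it moves at 45 degrees to the sides. *)
Definition ball_state (R : realType) : Type := ((R * R) * (R * R))%type.

(* Time needed, at position x in [0, L] and velocity v = 1 or -1, to reach the
   endpoint of [0, L] towards which v points. *)
Definition hit_time (R : realType) (L x v : R) : R :=
  if 0 < v then L - x else x.

(* The ball goes straight until it first meets a side, where the velocity
   component normal to that side changes sign. At a corner both components
   change sign; this is only relevant after the ball should have stopped in a
   pocket, since a ball leaving a pocket only meets integer points. *)
Definition bounce (R : realType) (T : table R) (s : ball_state R) :
    ball_state R :=
  let: ((x, y), (u, v)) := s in
  let tx := hit_time (width T) x u in
  let ty := hit_time (height T) y v in
  let t := Num.min tx ty in
  ((x + t * u, y + t * v),
   (if t == tx then - u else u, if t == ty then - v else v)).

(* Departure from the corner z along the inward bisector. *)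
Definition launch (R : realType) (z : R * R) : ball_state R :=
  (z, (if z.1 == 0 then 1 else -1, if z.2 == 0 then 1 else -1)).

(* Position at the k-th contact with the boundary of the ball launched at z
   (position z for k = 0). *)
Definition ball_at (R : realType) (T : table R) (z : R * R) (k : nat) : R * R :=
  (iter k (bounce T) (launch z)).1.

(* The ball launched at the pocket p first reaches a pocket again at its m-th
   contact with the boundary, and this pocket is q. *)
Definition path_ends (R : realType) (T : table R) (p q : R * R) (m : nat) :
    Prop :=
  [/\ (0 < m)%N, ball_at T p m = q, pocket T q
    & forall k, (0 < k < m)%N -> ~ pocket T (ball_at T p k)].

Definition path_touches (R : realType) (T : table R) (p q z : R * R) : Prop :=
  exists m k : nat, [/\ path_ends T p q m, (k <= m)%N & z = ball_at T p k].

(* Main.v *)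
Require Import Defs.
From mathcomp Require Import all_boot all_order all_algebra.
From mathcomp Require Import reals.
From mathcomp Require Import ring lra zify.

Set Implicit Arguments.
Unset Strict Implicit.
Unset Printing Implicit Defensive.

Import Order.TTheory GRing.Theory Num.Theory.
Local Open Scope ring_scope.

(** Modulo the perimeter N = C - A, a 45 degree segment joins x to B - x if its
    slope is 1 and to A - x if its slope is -1, and the slope alternates as long
    as no corner is hit. A pocket is fixed by one of the two reflections, so the
    ball launched at x0 has met after k bounces the points x0 + i (B - A) for k + 1
    consecutive values of i (up to the sign of B - A). All of them are
    congruent to x0 modulo gcd (B - A, C - B), a divisor of N; when this gcd is
    1, they are distinct for k < N, and only the last one is again fixed by a
    reflection. *)

Section Rectangle.
Variables (R : realType) (a b c d : R).
Hypotheses (ltab : a < b) (ltbc : b < c) (dE : d = c + b - a).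

Let T := Table a b c d.
Let P : R := 2 * (c - a).

Definition same_coord (x y : R) : Prop := (x - y) / P \is a Num.int.

(* [on_side t z]: z has coordinate t, taken in [a, a + P]; corners lie on two
   sides, and the corner a has both coordinates a and a + P. *)
Inductive on_side (t : R) : R * R -> Prop :=
| OnBottom of a <= t & t <= b : on_side t (t - a, 0)
| OnRight of b <= t & t <= c : on_side t (b - a, t - b)
| OnTop of c <= t & t <= d : on_side t (b - a - (t - c), c - b)
| OnLeft of d <= t & t <= a + P : on_side t (0, c - b - (t - d)).

Definition inward (z w : R * R) : Prop :=
  [/\ w.1 = 1 \/ w.1 = -1, w.2 = 1 \/ w.2 = -1,
      (z.1 = 0 -> w.1 = 1) /\ (z.1 = b - a -> w.1 = -1)
    & (z.2 = 0 -> w.2 = 1) /\ (z.2 = c - b -> w.2 = -1)].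

Let P_neq0 : P != 0.
Proof. by apply/eqP; rewrite /P; move: ltab ltbc; lra. Qed.

Lemma same_coord_refl x : same_coord x x.
Proof. by rewrite /same_coord subrr mul0r rpred0. Qed.

Lemma same_coord_sym x y : same_coord x y -> same_coord y x.
Proof. by rewrite /same_coord -(opprB x) mulNr rpredN. Qed.

Lemma same_coord_trans y x z :
  same_coord x y -> same_coord y z -> same_coord x z.
Proof.
move=> xy yz; have := rpredD xy yz.
by rewrite -mulrDl (_ : x - y + (y - z) = x - z) //; ring.
Qed.

Lemma same_coordDP x : same_coord (x + P) x.
Proof.
by rewrite /same_coord (_ : x + P - x = P) ?divff ?rpred1 //; ring.
Qed.

Lemma same_coordB s x y : same_coord x y -> same_coord (s - x) (s - y).
Proof.
move=> xy; have := same_coord_sym xy; rewrite /same_coord.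
by rewrite (_ : s - x - (s - y) = y - x) //; ring.
Qed.

Lemma boundary_point_same x y :
  same_coord x y -> boundary_point T x = boundary_point T y.
Proof.
move=> /intrP[k xyk].
have {xyk} -> : x = y + k%:~R * P.
  by rewrite -xyk divfK //; ring.
rewrite /boundary_point /perimeter /= -/P.
have -> : (y + k%:~R * P - a) / P = (y - a) / P + k%:~R by field.
rewrite floorDrz ?intr_int // intrKfloor rmorphD /=.
set f := (Num.floor _)%:~R.
by have -> : y + k%:~R * P - (f + k%:~R) * P = y - f * P by ring.
Qed.

Lemma boundary_point_on_side t z : on_side t z -> z = boundary_point T t.
Proof.
have bp0 s : a <= s -> s < a + P -> boundary_point T s =
    if s <= b then (s - a, 0) else if s <= c then (b - a, s - b)
    else if s <= d then (b - a - (s - c), c - b) else (0, c - b - (s - d)).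
  move=> le_as lt_s; rewrite /boundary_point /perimeter /= -/P.
  have P0 : 0 < P by rewrite /P; move: ltab ltbc; lra.
  have -> : Num.floor ((s - a) / P) = 0.
    apply/Num.Theory.floor_def; rewrite add0r divr_ge0 ?ltr_pdivrMr ?mul1r //; lra.
  by rewrite mul0r subr0.
have [E|lt_t] := eqVneq t (a + P).
  rewrite E (boundary_point_same (same_coordDP a)) bp0 //; last first.
  - by rewrite /P; move: ltab ltbc; lra.
  rewrite (ltW ltab) subrr => tz.
  move: E; case: tz; rewrite /P => *; try (exfalso; move: ltab ltbc dE; lra).
  by congr (_, _); move: ltab ltbc dE; lra.
move/eqP: lt_t => lt_t tz; rewrite bp0; first last.
- by case: tz lt_t; rewrite /P => *; move: ltab ltbc dE; lra.
- by case: tz lt_t; rewrite /P => *; move: ltab ltbc dE; lra.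
case: tz lt_t; rewrite /P => H1 H2 lt_t.
- by rewrite H2.
- rewrite H2; case: leP => // H3; congr (_, _); move: ltab ltbc dE; lra.
- case: leP => H3; first by exfalso; move: ltab ltbc dE; lra.
  by case: leP => H4; rewrite ?H2 //; congr (_, _); move: ltab ltbc dE; lra.
- case: leP => H3; first by exfalso; move: ltab ltbc dE; lra.
  case: leP => H4; first by exfalso; move: ltab ltbc dE; lra.
  by case: leP => H5 //; congr (_, _); move: ltab ltbc dE; lra.
Qed.

Lemma boundary_pointP x :
  exists2 t, same_coord x t & on_side t (boundary_point T x).
Proof.
pose f := Num.floor ((x - a) / P); exists (x - f%:~R * P).
  by rewrite /same_coord subKr mulfK // intr_int.
have P0 : 0 < P by rewrite /P; move: ltab ltbc; lra.
have [] : f%:~R * P <= x - a /\ x - a < (f%:~R + 1) * P.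
  rewrite -ler_pdivlMr // -ltr_pdivrMr // floor_le //.
  by have := floorD1_gt ((x - a) / P); rewrite rmorphD.
rewrite /boundary_point /perimeter /= -/P -/f mulrDl mul1r.
set g := _%:~R * _ => lo hi.
case: leP => H1; first by constructor; lra.
case: leP => H2; first by constructor; lra.
case: leP => H3; first by constructor; lra.
by constructor; lra.
Qed.

Lemma boundary_point_inj x y :
  boundary_point T x = boundary_point T y -> same_coord x y.
Proof.
have [t xt tz] := boundary_pointP x; have [s ys sz] := boundary_pointP y.
move=> exy; apply: same_coord_trans xt _; apply: same_coord_sym.
apply: same_coord_trans ys _; move: tz sz; rewrite exy.
set z := boundary_point T y => tz sz.
suff [->|[->|->]] : s = t \/ s = t + P \/ t = s + P.
- exact: same_coord_refl.
- exact: same_coordDP.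
- exact/same_coord_sym/same_coordDP.
move: sz; case: tz => H1 H2 sz; inversion sz; move: ltab ltbc dE; rewrite /P; lra.
Qed.

Lemma on_sideI t x y :
    [\/ [/\ a <= t, t <= b, x = t - a & y = 0],
        [/\ b <= t, t <= c, x = b - a & y = t - b],
        [/\ c <= t, t <= d, x = b - a - (t - c) & y = c - b]
      | [/\ d <= t, t <= a + P, x = 0 & y = c - b - (t - d)]] ->
  on_side t (x, y).
Proof. by case=> -[H1 H2 -> ->]; constructor. Qed.

Lemma bounce_on_side t z u v : on_side t z -> inward z (u, v) ->
  exists2 s, same_coord (2 * (if u == v then b else a) - t) s
           & on_side s (bounce T (z, (u, v))).1.
Proof.
have shift s r : r = s \/ r = s + P \/ r = s - P -> same_coord r s.
  case=> [->|[->|->]]; [exact: same_coord_refl|exact: same_coordDP|].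
  apply: same_coord_sym; have := same_coordDP (s - P).
  by rewrite subrK.
suff H : on_side t z -> inward z (u, v) -> exists2 s,
    (2 * (if u == v then b else a) - t = s \/
     2 * (if u == v then b else a) - t = s + P \/
     2 * (if u == v then b else a) - t = s - P) &
    on_side s (bounce T (z, (u, v))).1.
  by move=> /H{}H /H[s /shift]; exists s.
have N1 : (-1 == 1 :> R) = false by apply/negP => /eqP; lra.
have N1' : (1 == -1 :> R) = false by apply/negP => /eqP; lra.
have L1 : (0 < -1 :> R) = false by apply/negP; lra.
case=> H1 H2 [/= Hu Hv [x0 xw] [y0 yh]];
case: Hu Hv x0 xw y0 yh => -> [] -> x0 xw y0 yh;
rewrite ?eqxx ?N1 ?N1' /bounce /hit_time /width /height /= ?ltr01 ?L1;
rewrite minEle; case: leP => H3; try by [have := x0 erefl; lra|have := xw erefl; lra|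
  have := y0 erefl; lra|have := yh erefl; lra].
all: move: ltab ltbc dE => h1 h2 h3; clear shift N1 N1' L1 x0 xw y0 yh.
all: try rewrite /P in H2.
all: let on_side_at s := (exists s; [rewrite /P; lra|apply: on_sideI; rewrite /P;
    first [apply: Or41; split; lra | apply: Or42; split; lra
         | apply: Or43; split; lra | apply: Or44; split; lra]]) in
  match goal with |- exists2 _, ?r = _ \/ _ & _ =>
    first [on_side_at r | on_side_at (r - P) | on_side_at (r + P)] end.
Qed.

Lemma bounce_inward x y u v :
    0 <= x <= b - a -> 0 <= y <= c - b -> inward (x, y) (u, v) ->
  exists z' u' v', [/\ bounce T ((x, y), (u, v)) = (z', (u', v')),
    inward z' (u', v')
    & (z'.1 = 0 \/ z'.1 = b - a) /\ (z'.2 = 0 \/ z'.2 = c - b)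
      \/ (u' == v') = (u != v)].
Proof.
move=> /andP[x0 xw] /andP[y0 yh] [/= Hu Hv [ux0 uxw] [vy0 vyh]].
have N1 : (-1 == 1 :> R) = false by apply/negP => /eqP; lra.
have N1' : (1 == -1 :> R) = false by apply/negP => /eqP; lra.
have L1 : (0 < -1 :> R) = false by apply/negP; lra.
rewrite /bounce /hit_time /width /height /= minElt.
do 3!eexists; split; first reflexivity.
all: case: Hu Hv ux0 uxw vy0 vyh => -> [] -> ux0 uxw vy0 vyh.
all: rewrite ?ltr01 ?L1 /=.
all: case: ltgtP => H3; rewrite ?eqxx ?(gt_eqF H3) ?(lt_eqF H3) ?opprK ?N1 ?N1' ?eqxx /=.
all: try (rewrite -H3 eqxx).
all: rewrite ?N1 ?N1' ?opprK ?eqxx.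
all: try (by right); try (left; lra).
all: split; rewrite /=; lra.
Qed.

(* The conclusion keeps [inward] at corners too, where the slope does not
   change; elsewhere the sign of the slope, tested by [u == v], alternates. *)
Lemma bounceP x u v :
    let z := boundary_point T x in inward z (u, v) ->
  exists u' v', let z' := boundary_point T (2 * (if u == v then b else a) - x) in
    [/\ bounce T (z, (u, v)) = (z', (u', v')), inward z' (u', v')
      & (exists2 e, e \in corners T & z' = boundary_point T e)
        \/ (u' == v') = (u != v)].
Proof.
move=> z zuv; have [t xt zt] := boundary_pointP x.
have [s ts] := bounce_on_side zt zuv; rewrite -/z.
have [z0 zw] : 0 <= z.1 <= b - a /\ 0 <= z.2 <= c - b.
  split; apply/andP; rewrite -/z in zt;
  case: zt => /= H1 H2; move: ltab ltbc dE H1 H2; rewrite /P; lra.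
case: z zuv z0 zw {zt} => zx zy zuv z0 zw.
have [z' [u' [v' [-> z'uv sides]]]] := bounce_inward z0 zw zuv.
move=> /boundary_point_on_side /= z's; exists u', v'.
have <- : z' = boundary_point T (2 * (if u == v then b else a) - x).
  rewrite z's; apply/esym/boundary_point_same.
  exact: same_coord_trans (same_coordB _ xt) ts.
split=> //; case: sides => [H|]; [left | by right].
have corner e : on_side e z' -> e \in corners T ->
    exists2 e, e \in corners T & z' = boundary_point T e.
  by move=> /boundary_point_on_side; exists e.
case: z' {z's z'uv} corner H => x' y' corner [/= Hx Hy].
move: corner; case: Hx Hy => -> [] -> corner.
- apply: (corner a (on_sideI _)); last by rewrite !inE eqxx.
  by apply: Or41; split; move: ltab ltbc; lra.
- apply: (corner d (on_sideI _)); last by rewrite !inE eqxx !orbT.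
  by apply: Or43; split; move: ltab ltbc dE; lra.
- apply: (corner b (on_sideI _)); last by rewrite !inE eqxx orbT.
  by apply: Or41; split; move: ltab ltbc; lra.
- apply: (corner c (on_sideI _)); last by rewrite !inE eqxx !orbT.
  by apply: Or42; split; move: ltab ltbc; lra.
Qed.

End Rectangle.

Fixpoint contact (M0 M1 x0 : int) (k : nat) : int :=
  if k is j.+1 then (if odd j then M0 else M1) - contact M0 M1 x0 j else x0.

Lemma contactE M0 M1 x0 k :
  contact M0 M1 x0 k = if odd k then M1 - x0 + k./2%:Z * (M1 - M0)
                       else x0 - k./2%:Z * (M1 - M0).
Proof.
elim: k => [|k IHk] /=; first by ring.
rewrite IHk uphalf_half; case: (odd k) => /=; last by ring.
by rewrite PoszD; ring.
Qed.

Section Contact.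
Variables (N : nat) (M0 M1 x0 : int).
Hypothesis start : (N %| x0 + x0 - M0)%Z.

Let x := contact M0 M1 x0.

Lemma contact_mod (g : int) k :
  (g %| N%:Z)%Z -> (g %| M1 - M0)%Z -> (g %| x k - x0)%Z.
Proof.
move=> gN gM; have g0 := dvdz_trans gN start.
rewrite /x contactE; case: (odd k).
  rewrite (_ : _ - x0 = (k./2%:Z + 1) * (M1 - M0) - (x0 + x0 - M0)); last by ring.
  by rewrite rpredB ?dvdz_mull.
rewrite (_ : _ - x0 = - k./2%:Z * (M1 - M0)); last by ring.
by rewrite dvdz_mull.
Qed.

Hypothesis coN : coprimez N (M1 - M0).

Lemma contact_neq_fixed k : (0 < k < N.-1)%N ->
  ~~ (N %| x k + x k - M0)%Z && ~~ (N %| x k + x k - M1)%Z.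
Proof.
move=> k_bound.
have ndvd j : (0 < j < N)%N -> ~~ (N %| j%:Z * (M1 - M0))%Z.
  move=> /andP[j0 jN]; rewrite Gauss_dvdzl //.
  by rewrite dvdzE /= gtnNdvd.
have := ndvd k ltac:(lia); have := ndvd k.+1 ltac:(lia).
have dvdBs y : (N %| y - (x0 + x0 - M0))%Z = (N %| y)%Z by exact: rpredBr.
rewrite /x contactE; have := odd_double_half k.
move: (k./2) => h; case: (odd k) => /= Ek.
  set u := (X in ~~ (_ %| X)%Z -> _); set v := (X in _ -> ~~ (_ %| X)%Z -> _).
  have Eu : M1 - x0 + h%:Z * (M1 - M0) + (M1 - x0 + h%:Z * (M1 - M0)) - M0
    = u - (x0 + x0 - M0) by rewrite /u -Ek; lia.
  have Ev : M1 - x0 + h%:Z * (M1 - M0) + (M1 - x0 + h%:Z * (M1 - M0)) - M1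
    = v - (x0 + x0 - M0) by rewrite /v -Ek; lia.
  by rewrite Eu Ev !dvdBs => -> ->.
set u := (X in ~~ (_ %| X)%Z -> _); set v := (X in _ -> ~~ (_ %| X)%Z -> _).
have Eu : x0 - h%:Z * (M1 - M0) + (x0 - h%:Z * (M1 - M0)) - M0
  = - (v - (x0 + x0 - M0)) by rewrite /v -Ek; lia.
have Ev : x0 - h%:Z * (M1 - M0) + (x0 - h%:Z * (M1 - M0)) - M1
  = - (u - (x0 + x0 - M0)) by rewrite /u -Ek; lia.
by rewrite Eu Ev !rpredN !dvdBs => -> ->.
Qed.

(* After k steps the contacts are, modulo N, the x0 + i (M1 - M0) with
   - k / 2 <= i <= (k + 1) / 2. *)
Lemma contact_surj n : (0 < N)%N -> exists2 k, (k < N)%N & (N %| n - x k)%Z.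
Proof.
move=> N0; have /coprimezP[[u v] /= uv] := coN.
pose i := ((n - x0) * v %% N%:Z)%Z.
have i0 : 0 <= i by rewrite modz_ge0 //; lia.
have iN : i < N by rewrite ltz_pmod //; lia.
have ni : (N %| n - x0 - i * (M1 - M0))%Z.
  have -> : n - x0 - i * (M1 - M0) = (n - x0) * u * N%:Z
      + ((n - x0) * v - i) * (M1 - M0).
    by rewrite -{1}[n - x0]mulr1 -{1}uv; ring.
  apply: rpredD; [exact: dvdz_mull | apply: dvdz_mulr].
  by rewrite {1}(divz_eq ((n - x0) * v) N) -/i addrK dvdz_mull.
have [i_le|i_gt] := boolP (i + i <= N).
  have [i_eq0|i_neq0] := eqVneq i 0.
    by exists 0%N => //; rewrite i_eq0 mul0r subr0 in ni.
  exists (`|i|.*2.-1)%N; first by lia.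
  rewrite /x contactE.
  have -> : odd (`|i|.*2.-1)%N by lia.
  have -> : (`|i|.*2.-1)./2%:Z = i - 1 by lia.
  have -> : n - (M1 - x0 + (i - 1) * (M1 - M0)) =
      n - x0 - i * (M1 - M0) + (x0 + x0 - M0) by ring.
  by rewrite rpredD.
exists (`|N%:Z - i|.*2)%N; first by lia.
rewrite /x contactE odd_double doubleK.
have -> : `|N%:Z - i|%:Z = N%:Z - i by lia.
have -> : n - (x0 - (N%:Z - i) * (M1 - M0)) =
    n - x0 - i * (M1 - M0) + (M1 - M0) * N%:Z by ring.
by rewrite rpredD // dvdz_mull.
Qed.

End Contact.

Section Trajectory.
Variables (R : realType) (a b c d : R).
Hypotheses (ltab : a < b) (ltbc : b < c) (dE : d = c + b - a).

Let T := Table a b c d.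

Lemma launchP e : e \in corners T ->
  exists (s : bool) (u v : R),
    [/\ launch (boundary_point T e) = (boundary_point T e, (u, v)),
        inward a b c (boundary_point T e) (u, v), (u == v) = s
      & 2 * e = 2 * (if s then a else b)
        \/ 2 * e = 2 * (if s then a else b) + perimeter T].
Proof.
have corner x y :
    [\/ e = a /\ (x, y) = (0, 0), e = b /\ (x, y) = (b - a, 0),
        e = c /\ (x, y) = (b - a, c - b) | e = d /\ (x, y) = (0, c - b)] ->
    boundary_point T e = (x, y).
  move=> H; apply/esym/(boundary_point_on_side ltab ltbc dE); apply: on_sideI.
  case: H => -[-> [-> ->]]; [apply: Or41|apply: Or41|apply: Or42|apply: Or43];
    split; move: ltab ltbc dE; lra.
have N1 : (-1 == 1 :> R) = false by apply/negP => /eqP; lra.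
have N1' : (1 == -1 :> R) = false by apply/negP => /eqP; lra.
have w0 : (b - a == 0) = false by apply/negP => /eqP; move: ltab; lra.
have h0 : (c - b == 0) = false by apply/negP => /eqP; move: ltbc; lra.
rewrite !inE => /or4P[] /eqP ee.
- exists true, 1, 1; rewrite (corner 0 0); last exact: Or41.
  rewrite /launch /= !eqxx; split=> //; last by left; rewrite ee.
  by split=> /=; [left|left|split=> //; move: ltab; lra|split=> //; move: ltbc; lra].
- exists false, (-1), 1; rewrite (corner (b - a) 0); last exact: Or42.
  rewrite /launch /= !eqxx w0 N1; split=> //; last by left; rewrite ee.
  by split=> /=; [right|left|split=> //; move: ltab; lra|split=> //; move: ltbc; lra].
- exists true, (-1), (-1); rewrite (corner (b - a) (c - b)); last exact: Or43.
  rewrite /launch /= !eqxx w0 h0; split=> //; last first.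
    by right; rewrite ee /perimeter /=; ring.
  by split=> /=; [right|right|split=> //; move: ltab; lra|split=> //; move: ltbc; lra].
- exists false, 1, (-1); rewrite (corner 0 (c - b)); last exact: Or44.
  rewrite /launch /= !eqxx h0 N1'; split=> //; last first.
    by right; rewrite ee /perimeter /= dE; ring.
  by split=> /=; [left|right|split=> //; move: ltab; lra|split=> //; move: ltbc; lra].
Qed.

Lemma iter_bounce (f : nat -> R) s u v k :
    (forall j, f j.+1 = 2 * (if s (+) odd j then b else a) - f j) ->
    inward a b c (boundary_point T (f 0)) (u, v) -> (u == v) = s ->
    (forall j, (0 < j < k)%N ->
       forall e, e \in corners T -> boundary_point T (f j) <> boundary_point T e) ->
  (iter k (bounce T) (boundary_point T (f 0), (u, v))).1
    = boundary_point T (f k).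
Proof.
move=> fS uv0 s0 not_corner.
suff [u' [v' [-> _ _]]] : exists u' v',
    [/\ iter k (bounce T) (boundary_point T (f 0), (u, v))
        = (boundary_point T (f k), (u', v')),
        inward a b c (boundary_point T (f k)) (u', v')
      & (k = 0)%N \/ (forall e, e \in corners T ->
           boundary_point T (f k) <> boundary_point T e) ->
        (u' == v') = s (+) odd k] by [].
elim: k not_corner => [|k IHk] not_corner.
  by exists u, v; split=> //; rewrite addbF.
have /IHk[u1 [v1 [iterE uv1 s1]]] : forall j, (0 < j < k)%N ->
    forall e, e \in corners T -> boundary_point T (f j) <> boundary_point T e.
  by move=> j /andP[j0 jk]; apply: not_corner; rewrite j0 ltnW.
have {}s1 : (u1 == v1) = s (+) odd k.
  apply: s1; case: (posnP k) => [k0|k0]; first by left.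
  by right; apply: not_corner; rewrite k0 ltnSn.
have [u2 [v2 []]] := bounceP ltab ltbc dE uv1.
rewrite s1 -fS => bE uv2 flip; exists u2, v2; split=> //.
  by rewrite iterS iterE.
case: flip => [[e eT feE]|->]; last by rewrite /= addbN.
by case=> // /(_ e eT).
Qed.

End Trajectory.
Theorem mainTheorem3 (R : realType) (A B C D : nat) (a b c d : R)
    (A_gt0 : (0 < A)%N) (ltAB : (A < B)%N) (ltBC : (B < C)%N)
    (ltCD : (C < D)%N) (eqP : (C - A = D - B)%N)
    (aE : a = A%:R / 2) (bE : b = B%:R / 2)
    (cE : c = C%:R / 2) (dE : d = D%:R / 2)
    (two_integers : count (fun e : R => e \is a Num.int) [:: a; b; c; d] = 2%N)
    (p q : R * R)
    (p_pocket : pocket (Table a b c d) p)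
    (q_pocket : pocket (Table a b c d) q)
    (p_neq_q : p <> q) :
  (forall z : R * R, integer_point (Table a b c d) z ->
     path_touches (Table a b c d) p q z)
  <-> coprime (B - A) (C - B).
Proof.
set T := Table a b c d.
have ltab : a < b by rewrite aE bE ltr_pM2r ?invr_gt0 ?ltr_nat.
have ltbc : b < c by rewrite bE cE ltr_pM2r ?invr_gt0 ?ltr_nat.
have ddE : d = c + b - a.
  have DE : D = (C + B - A)%N by lia.
  by rewrite dE DE natrB ?natrD ?aE ?bE ?cE; [field | lia].
have [N NE] : exists N : nat, N = (C - A)%N by exists (C - A)%N.
have PE : perimeter T = N%:R.
  by rewrite /perimeter /= NE natrB ?aE ?cE; [field | lia].
have N_neq0 : N%:R != 0 :> R by rewrite pnatr_eq0; lia.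
have same_coordE y z : same_coord a c y z <-> exists i : int, y = z + (i * N)%:~R.
  rewrite /same_coord -[2 * (c - a)]/(perimeter T) PE.
  split=> [/intrP[i]|[i ->]]; last first.
    by rewrite addrC addKr rmorphM /= mulfK // intr_int.
  move/(canRL (divfK N_neq0)) => yz; exists i.
  by rewrite rmorphM /= -yz addrC subrK.
have bp_int (n k : int) :
    boundary_point T n%:~R = boundary_point T k%:~R <-> (N%:Z %| n - k)%Z.
  split=> [/(boundary_point_inj ltab ltbc ddE)/same_coordE[i nk]|/dvdzP[i nk]].
    apply/dvdzP; exists i; apply/(@intr_inj R).
    by rewrite rmorphB /= nk addrC addKr.
  apply: boundary_point_same => //; apply/same_coordE; exists i.
  by rewrite -nk -rmorphD /= addrC subrK.
pose M (s : bool) : int := if s then A else B.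
have double_corner s e i (n : int) :
    2 * e = 2 * (if s then a else b) \/
    2 * e = 2 * (if s then a else b) + perimeter T ->
    n%:~R = e + (i * N%:Z)%:~R -> (N%:Z %| n + n - M s)%Z.
  have -> : 2 * (if s then a else b) = (M s)%:~R.
    by rewrite /M aE bE; case: (s); rewrite -pmulrn; field.
  rewrite PE => e2 ne; apply/dvdzP; case: e2 => e2.
    exists (i + i); apply/(@intr_inj R).
    by rewrite rmorphB rmorphD /= ne mulrDl rmorphD /= -e2; ring.
  exists (i + i + 1); apply/(@intr_inj R); move: e2; rewrite pmulrn => e2.
  rewrite rmorphB rmorphD /= ne !mulrDl mul1r !rmorphD /=.
  have -> : (M s)%:~R = 2 * e - N%:~R by rewrite e2 addrK.
  by ring.
have [e0 [e0T /intrP[x0 e0E] pE]] := p_pocket.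
have [s [u [v [launchE uv sE e0s]]]] := launchP ltab ltbc ddE e0T.
have start : (N%:Z %| x0 + x0 - M s)%Z.
  by apply: (double_corner s e0 0) => //; rewrite mul0r addr0 e0E.
pose x := contact (M s) (M (~~ s)) x0.
have cornerP (n : int) e : e \in corners T ->
    boundary_point T n%:~R = boundary_point T e ->
    pocket T (boundary_point T n%:~R) /\
    ((N%:Z %| n + n - M s)%Z \/ (N%:Z %| n + n - M (~~ s))%Z).
  move=> eT ne; have /same_coordE[i nei] := boundary_point_inj ltab ltbc ddE ne.
  split.
    exists e; split=> //; have -> : e = (n - i * N)%:~R.
      by rewrite rmorphB /= nei addrK.
    exact: intr_int.
  have [s1 [_ [_ [_ _ _ e1]]]] := launchP ltab ltbc ddE eT.
  have := double_corner _ _ _ _ e1 nei.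
  by case: (s1) (s) => -[]; [left|right|right|left].
have ballE k : (forall j, (0 < j < k)%N -> ~ pocket T (ball_at T p j)) ->
    ball_at T p k = boundary_point T (x k)%:~R.
  elim/ltn_ind: k => k IHk no_pocket.
  rewrite /ball_at pE launchE e0E.
  apply: (iter_bounce (f := fun j => (x j)%:~R) (s := s) ltab ltbc ddE).
  - move=> j; rewrite /x /= rmorphB /=; congr (_ - _).
    by rewrite /M aE bE; case: (s); case: (odd j); rewrite /= -pmulrn; field.
  - by rewrite /x /= -e0E.
  - exact: sE.
  move=> j /andP[j0 jk] e eT /cornerP[] // jpocket _.
  apply: (no_pocket j); first by rewrite j0.
  rewrite IHk // => i /andP[i0 ij].
  by apply: no_pocket; rewrite i0 (ltn_trans ij).
have ME : `|M (~~ s) - M s|%N = (B - A)%N by rewrite /M; case: (s) => /=; lia.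
have NE' : N = (B - A + (C - B))%N by lia.
split=> [all_touched|co].
  have [|m [k [[_ _ _ no_pocket] km]]] :=
    all_touched (boundary_point T (x0 + 1)%:~R).
    by exists (x0 + 1).
  rewrite ballE => [/bp_int x0k|j /andP[j0 jk]]; last first.
    by apply: no_pocket; rewrite j0 (leq_trans jk).
  set g := gcdn (B - A) (C - B).
  have gN : (g%:Z %| N%:Z)%Z.
    by rewrite dvdzE /= NE' dvdn_add ?dvdn_gcdl ?dvdn_gcdr.
  have gM : (g%:Z %| M (~~ s) - M s)%Z by rewrite dvdzE ME dvdn_gcdl.
  have := rpredD (dvdz_trans gN x0k) (@contact_mod _ _ _ _ start _ k gN gM).
  by rewrite -/x addrA subrK addrC addKr dvdz1.
have {}co : coprimez N (M (~~ s) - M s).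
  by rewrite coprimezE ME NE' /= /coprime gcdnC gcdnDl.
have N0 : (0 < N)%N by lia.
have interior k : (0 < k < N.-1)%N -> ~ pocket T (boundary_point T (x k)%:~R).
  move=> /(contact_neq_fixed start co)/andP[/negP n0 /negP n1].
  by move=> [e [eT _ /cornerP[] // _ []]].
have {}ballE k : (k < N)%N -> ball_at T p k = boundary_point T (x k)%:~R.
  elim/ltn_ind: k => k IHk kN; apply: ballE => j /andP[j0 jk].
  by rewrite IHk // ?(ltn_trans jk) //; apply: interior; lia.
have hit n : exists2 k, (k < N)%N & boundary_point T n%:~R = ball_at T p k.
  have [k kN nk] := contact_surj start co n N0; exists k => //.
  by rewrite ballE //; apply/bp_int.
have ends : path_ends T p q N.-1.
  have [e1 [_ /intrP[n1 e1E] qE]] := q_pocket.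
  have [k kN qk] := hit n1; rewrite -e1E -qE in qk.
  have Nk : N.-1 = k.
    have k0 : k <> 0%N by move=> k0; apply: p_neq_q; rewrite qk k0 /ball_at.
    have [k_lt|] := boolP (k < N.-1)%N; last by lia.
    by case: (@interior k); [lia | rewrite -ballE // -qk].
  split=> //; [lia | by rewrite Nk | move=> j jN].
  by rewrite ballE; [exact: interior | lia].
move=> z [n ->]; have [k kN ->] := hit n.
by exists N.-1, k; split=> //; lia.
Qed.
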